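(* For every even and square-free integer $b$, the sequence $(\mathfrak{S}_b(n))_{n\geq 1}$ is not eventually periodic.
   Context: For an integer $b\geq 2$ and a positive integer $n$, $L_b(n)\in\{1,\dots,b-1\}$ denotes the last non-zero digit of $n$ in base $b$; that is, writing $n=b^r n'$ with $r\geq 0$ and $b\nmid n'$, $L_b(n)$ is the residue of $n'$ modulo $b$. Define $\mathfrak{S}_b(n):=L_b(n^n)$, the last non-zero digit of $n^n$ in base $b$. A sequence $a(n)$ is eventually periodic if there are $n_0$ and $T\geq 1$ with $a(n+T)=a(n)$ for all $n\geq n_0$.
   Formalization: The base b = 2 is excluded: it is even and square-free, but the last non-zero digit in base 2 is always 1, so the sequence is constant and hence eventually periodic; the claim is proved for every even square-free b > 2. *)

(* Defs.v *)
From mathcomp Require Import all_boot.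

Set Implicit Arguments.
Unset Strict Implicit.
Unset Printing Implicit Defensive.

Definition square_free (n : nat) : Prop := forall d : nat, d ^ 2 %| n -> d = 1.

(* The largest r with b ^ r %| n, for 1 < b and 0 < n: every such r satisfies
   r < b ^ r <= n, so the range r < n.+1 loses nothing.  [logn b n] would be
   wrong here, since it is 0 whenever b is not prime. *)
Definition base_valuation (b n : nat) : nat :=
  \max_(r < n.+1 | b ^ r %| n) r.

(* Meaningful for 1 < b and 0 < n. *)
Definition last_nonzero_digit (b n : nat) : nat :=
  (n %/ b ^ base_valuation b n) %% b.

(* The index 0 is outside the intended range; 0 ^ 0 = 1 there. *)
Definition lnd_self_power (b n : nat) : nat := last_nonzero_digit b (n ^ n).

(* For a sequence indexed from 1, the value a 0 is irrelevant: if n0 = 0 is a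
   witness then so is n0 = 1. *)
Definition eventually_periodic (a : nat -> nat) : Prop :=
  exists n0 T : nat, 0 < T /\ forall n : nat, n0 <= n -> a (n + T) = a n.

(* Main.v *)
Require Import Defs.
From mathcomp Require Import all_boot.

(** Let [v b] denote the base-[b] valuation and [v p] the [p]-adic one.  If [b]
    is square-free and [p] is a prime divisor of [b], then the last non-zero
    digit of [n] is divisible by [p] exactly when [v b n < v p n], that is, when
    [p] is not one of the primes that limit how often [b] divides [n]
    ([dvdn_last_nonzero_digit]).

    An eventually periodic sequence of period [T] is constant on the large
    multiples of [T].  But among these one can choose which prime limits the
    division by [b]: multiplying by a high power of [b %/ q] raises the
    valuation at every prime divisor of [b] except [q], and makes [q] the only
    limiting prime ([limited_multiple]).  Raising to the power [n] multiplies
    all valuations by [n], so [q] is still the only limiting prime of [n ^ n].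
    If [p] and [q] are two distinct prime divisors of [b], the choice of [q]
    gives a digit divisible by [p], and the choice of [p] gives one that is not,
    so the digit is not constant on the large multiples of [T].  An even
    square-free [b > 2] has the prime divisor 2 and an odd one. *)

Lemma dvdn_base_valuation b n : b ^ base_valuation b n %| n.
Proof.
rewrite /base_valuation; elim/big_ind: _ => [|r s br bs|//].
  by rewrite expn0 dvd1n.
by rewrite /maxn; case: ifP.
Qed.

Lemma leq_base_valuation b n r :
  1 < b -> 0 < n -> b ^ r %| n -> r <= base_valuation b n.
Proof.
move=> b_gt1 n_gt0 br_n.
have r_lt : r < n.+1.
  by rewrite ltnS; apply: leq_trans (ltnW (ltn_expl r b_gt1)) (dvdn_leq n_gt0 br_n).
by rewrite /base_valuation; apply: (leq_bigmax_cond (Ordinal r_lt)).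
Qed.

Lemma logn_square_free b p :
  0 < b -> square_free b -> prime p -> p %| b -> logn p b = 1.
Proof.
move=> b_gt0 b_sqf p_pr p_b; apply/eqP; rewrite eqn_leq -[0 < _]pfactor_dvdn //.
rewrite expn1 p_b andbT leqNgt -pfactor_dvdn //; apply/negP => /b_sqf p1.
by rewrite p1 in p_pr.
Qed.

(** Each division by [b] removes exactly one factor [p]; reducing modulo [b]
    afterwards does not change divisibility by the divisor [p] of [b]. *)
Lemma dvdn_last_nonzero_digit b p n :
    prime p -> logn p b = 1 -> 0 < n ->
  (p %| last_nonzero_digit b n) = (base_valuation b n < logn p n).
Proof.
move=> p_pr pb1 n_gt0.
have p_b : p %| b by move: (pfactor_dvdnn p b); rewrite pb1.
have q_gt0 : 0 < n %/ b ^ base_valuation b n.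
  move: n_gt0; rewrite -{1}(divnK (dvdn_base_valuation b n)) muln_gt0.
  by case/andP.
rewrite /last_nonzero_digit /dvdn modn_dvdm // -/(dvdn p _).
rewrite -[p in LHS]expn1 pfactor_dvdn // logn_div ?dvdn_base_valuation //.
by rewrite lognX pb1 muln1 subn_gt0.
Qed.

(** Since [logn q b = 1], [logn q n] always bounds the base valuation from
    above, so one divisibility decides that it is attained. *)
Lemma base_valuation_limited b q n :
    1 < b -> logn q b = 1 -> 0 < n -> b ^ logn q n %| n ->
  base_valuation b n = logn q n.
Proof.
move=> b_gt1 qb1 n_gt0 bq_n; apply/eqP; rewrite eqn_leq leq_base_valuation //.
have := dvdn_leq_log q n_gt0 (dvdn_base_valuation b n).
by rewrite lognX qb1 muln1 => ->.
Qed.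

(** The prime [q] gains nothing from the power of [b %/ q], while the other
    prime divisors of [b] gain [T > logn q T], enough to overtake it whatever their valuations
    in [T] are.  The factor [b ^ N] makes the multiple of [T] large. *)
Definition limited_multiple b T N q := T * (b ^ N * (b %/ q) ^ T).

Section LimitedMultiple.

Variables (b T N q : nat).
Hypotheses (b_gt1 : 1 < b) (T_gt0 : 0 < T).
Hypotheses (q_pr : prime q) (qb1 : logn q b = 1).

Let q_b : q %| b.
Proof. by move: (pfactor_dvdnn q b); rewrite qb1. Qed.

Let bq_gt0 : 0 < b %/ q.
Proof. by rewrite divn_gt0 ?prime_gt0 // dvdn_leq // ltnW. Qed.

Let bN_gt0 : 0 < b ^ N.
Proof. by rewrite expn_gt0 ltnW. Qed.

Local Notation n := (limited_multiple b T N q).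

Lemma limited_multiple_gt0 : 0 < n.
Proof. by rewrite /limited_multiple !muln_gt0 T_gt0 bN_gt0 expn_gt0 bq_gt0. Qed.

Lemma logn_limited_multiple p :
  logn p n = logn p T + (N * logn p b + T * logn p (b %/ q)).
Proof.
rewrite /limited_multiple !lognM ?muln_gt0 ?bN_gt0 ?expn_gt0 ?bq_gt0 //.
by rewrite !lognX.
Qed.

Lemma logn_limiting : logn q n = logn q T + N.
Proof.
rewrite logn_limited_multiple logn_div // qb1 (logn_prime _ q_pr) eqxx.
by rewrite subnn muln0 addn0 muln1.
Qed.

(** [q ^ logn q T] divides [T], and the cofactor [(b %/ q) ^ logn q T] divides
    [(b %/ q) ^ T], so these [logn q T] copies of [b] add to the [N] explicit
    ones. *)
Lemma dvdn_limited_multiple : b ^ logn q n %| n.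
Proof.
rewrite logn_limiting expnD /limited_multiple mulnCA mulnC dvdn_mul //.
rewrite -{1}(divnK q_b) expnMn mulnC dvdn_mul ?pfactor_dvdnn //.
by rewrite dvdn_exp2l // ltnW // ltn_logl.
Qed.

Lemma logn_limiting_lt p :
  prime p -> p != q -> logn p b = 1 -> logn q n < logn p n.
Proof.
move=> p_pr pq pb1; rewrite logn_limiting logn_limited_multiple logn_div // pb1.
rewrite (logn_prime _ q_pr) (negPf pq) subn0 !muln1.
by rewrite addnCA [logn q T + N]addnC ltn_add2l ltn_addl // ltn_logl.
Qed.

Lemma base_valuation_limited_power :
  base_valuation b (n ^ n) = n * logn q n.
Proof.
rewrite (@base_valuation_limited _ q) ?lognX ?expn_gt0 ?limited_multiple_gt0 //.
by rewrite mulnC expnM dvdn_exp2r // dvdn_limited_multiple.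
Qed.

Lemma dvdn_lnd_limited_power p :
  prime p -> logn p b = 1 -> (p %| lnd_self_power b n) = (p != q).
Proof.
move=> p_pr pb1; rewrite /lnd_self_power dvdn_last_nonzero_digit //; last first.
  by rewrite expn_gt0 limited_multiple_gt0.
rewrite base_valuation_limited_power lognX ltn_pmul2l ?limited_multiple_gt0 //.
by have [->|pq] := eqVneq p q; [rewrite ltnn | rewrite logn_limiting_lt].
Qed.

End LimitedMultiple.

Lemma periodic_multiples (a : nat -> nat) n0 T k :
    0 < T -> (forall n, n0 <= n -> a (n + T) = a n) -> n0 <= k ->
  a (T * k) = a (T * n0).
Proof.
move=> T_gt0 aT /subnKC <-; elim: (k - n0) => [|i IHi]; first by rewrite addn0.
rewrite addnS mulnS addnC aT //.
by apply: leq_trans (leq_addr i n0) _; rewrite leq_pmull.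
Qed.

Lemma not_periodic_two_primes b p q :
    0 < b -> square_free b -> prime p -> prime q -> p != q ->
    p %| b -> q %| b ->
  ~ eventually_periodic (lnd_self_power b).
Proof.
move=> b_gt0 b_sqf p_pr q_pr pq p_b q_b [n0 [T [T_gt0 aT]]].
have b_gt1 : 1 < b by apply: leq_trans (prime_gt1 p_pr) (dvdn_leq b_gt0 p_b).
have pb1 := logn_square_free _ _ b_gt0 b_sqf p_pr p_b.
have qb1 := logn_square_free _ _ b_gt0 b_sqf q_pr q_b.
have a_const r : prime r -> r %| b ->
    lnd_self_power b (limited_multiple b T n0 r) = lnd_self_power b (T * n0).
  move=> r_pr r_b; apply: periodic_multiples => //.
  apply: leq_trans (ltnW (ltn_expl n0 b_gt1)) (leq_pmulr _ _).
  by rewrite expn_gt0 divn_gt0 ?prime_gt0 // dvdn_leq.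
have := dvdn_lnd_limited_power b T n0 q b_gt1 T_gt0 q_pr qb1 p p_pr pb1.
have := dvdn_lnd_limited_power b T n0 p b_gt1 T_gt0 p_pr pb1 p p_pr pb1.
by rewrite !a_const // eqxx pq => ->.
Qed.

Theorem proposition6 (b : nat) (b_gt2 : 2 < b) (b_even : ~~ odd b)
    (b_sqf : square_free b) :
  ~ eventually_periodic (lnd_self_power b).
Proof.
have b_gt0 : 0 < b by apply: leq_trans b_gt2.
have b2 : 2 %| b by rewrite dvdn2.
have m_gt1 : 1 < b %/ 2 by rewrite ltn_divRL.
have p_m := pdiv_dvd (b %/ 2); have p_pr := pdiv_prime m_gt1.
apply: (@not_periodic_two_primes b 2 (pdiv (b %/ 2))) => //.
- (* Otherwise 4 would divide [b]. *)
  apply/eqP => p2; rewrite -p2 in p_m.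
  suff /b_sqf : 2 ^ 2 %| b by [].
  by rewrite -(divnK b2) expnS expn1 dvdn_mul.
- exact: dvdn_trans p_m (dvdn_div b2).
Qed.
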